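(* Suppose that (c1) there is $L\ge0$ such that $|b(x)-b(y)|\le L|x-y|$ for all $x,y\in\mathbb R^d$; (c2) there are $K>0$ and $\mathcal R\ge0$ such that $\langle x-y,b(x)-b(y)\rangle\le-K|x-y|^2$ for all $x,y\in\mathbb R^d$ with $|x-y|\ge\mathcal R$; (c3) there is $\kappa_0>0$ such that $J_{\kappa_0}:=\inf_{|z|\le\kappa_0}\big(\mu\wedge(\delta_z*\mu)\big)(\mathbb R^d)>0$; and that $\lim_{h\to0^+}h/g(h)=0$. Let $h\in(0,\,2KL^{-2}\wedge L^{-1})$ be such that $h/g(h)\le\kappa_0(2L\mathcal R)^{-1}$. Put $$c=\frac{64hL\mathcal R}{g(h)^2\kappa_0^2J_{\kappa_0}}+1,\qquad a=\frac{4c(1+e^{-c\mathcal R})h\,g(h)\kappa_0L}{J_{\kappa_0}}+1,$$ $$\rho(x,y)=a\mathbf 1_{\{|x-y|>0\}}+1-e^{-c|x-y|}+ce^{-c\mathcal R}|x-y|.$$ Let $((X,Y),\mathbb P_{x,y})$ be the coupling described in the context, with parameter $\kappa=g(h)\kappa_0$. Then there is a constant $c_*\in(0,1)$ such that for all $x,y\in\mathbb R^d$, $$\mathbb E_{x,y}[\rho(X,Y)]\le(1-c_* )\rho(x,y).$$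
   Context: Setting: $b:\mathbb R^d\to\mathbb R^d$; $g$ is a continuous strictly increasing function on $[0,\infty)$ with $g(0)=0$; $\mu$ is a probability measure on $\mathbb R^d$. For $h>0$, consider the Markov chain on $\mathbb R^d$ with transitions $x\mapsto x+hb(x)+g(h)\xi$, where $\xi\sim\mu$. Write $\hat x=x+hb(x)$. For measures, $\mu\wedge\nu$ denotes the minimum (largest measure dominated by both). For $x\in\mathbb R^d$ and $\kappa>0$ put $(x)_\kappa=\big(1\wedge\frac{\kappa}{|x|}\big)x$ (with $(0)_\kappa=0$) and $\mu_x=\mu\wedge(\delta_x*\mu)$. If $\mathcal R=0$, $\kappa_0(2L\mathcal R)^{-1}$ is read as $+\infty$. (Conditions (c1), (c2) force $0<K\le L$.) Coupling with parameter $\kappa>0$: for $x,y\in\mathbb R^d$ let $v=g(h)^{-1}(\hat x-\hat y)_\kappa$. Under $\mathbb P_{x,y}$, $X=\hat x+g(h)z$ with $z$ distributed as $\mu$, and $\mu$ is split into three parts according to which - $Y=\hat y+g(h)(z+v)$ on the part $\frac12\mu_{-v}(dz)$, - $Y=\hat y+g(h)(z-v)$ on the part $\frac12\mu_{v}(dz)$, - $Y=\hat y+g(h)z$ on the part $\mu(dz)-\frac12\mu_{-v}(dz)-\frac12\mu_v(dz)$. That is, for bounded measurable $F$, $\mathbb E_{x,y}[F(X,Y)]$ is the sum of the integrals of $F(\hat x+g(h)z,\,Y(z))$ against the three measures with the corresponding $Y(z)$. *)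

(* Defs.v *)
From HB Require Import structures.
From mathcomp Require Import all_boot all_order all_algebra.
From mathcomp Require Import all_classical all_reals all_analysis.
From mathcomp Require Import measurable_realfun.

Set Implicit Arguments.
Unset Strict Implicit.
Unset Printing Implicit Defensive.

Import Order.TTheory GRing.Theory Num.Theory.
Import numFieldNormedType.Exports.

Local Open Scope classical_set_scope.
Local Open Scope ring_scope.

(* MathComp-Analysis norms ['rV[R]_d] with the sup norm, hence these. *)
Section euclidean.
Context {R : realType} {d : nat}.
Implicit Types x y : 'rV[R]_d.

Definition inner x y : R := \sum_(i < d) x 0 i * y 0 i.

Definition enorm x : R := Num.sqrt (inner x x).

(* [(0)_kappa = 0] because [kappa / 0 = 0] and [k *: 0 = 0]. *)
Definition truncate (kappa : R) x : 'rV[R]_d :=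
  Num.min 1 (kappa / enorm x) *: x.

End euclidean.

(* The sup-norm topology is the Euclidean one, so this is the Borel
   sigma-algebra. *)
Section borel_rV.
Context (R : realType) (d : nat).

Let borel : set (set 'rV[R]_d) := <<s [set A : set 'rV[R]_d | open A] >>.

Let borel0 : borel set0.
Proof. exact: sigma_algebra0. Qed.

Let borelC A : borel A -> borel (~` A).
Proof. exact: sigma_algebraC. Qed.

Let borel_bigcup (F : (set 'rV[R]_d)^nat) :
  (forall i, borel (F i)) -> borel (\bigcup_i F i).
Proof. exact: sigma_algebra_bigcup. Qed.

HB.instance Definition _ := @isMeasurable.Build default_measure_display
  'rV[R]_d borel borel0 borelC borel_bigcup.

Lemma measurable_rVE : @measurable _ 'rV[R]_d = <<s [set A | open A] >>.
Proof. by []. Qed.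

Lemma open_measurable_rV (A : set 'rV[R]_d) : open A -> measurable A.
Proof. exact: sub_sigma_algebra. Qed.

Lemma continuous_measurable_rV (f : 'rV[R]_d -> 'rV[R]_d) :
  continuous f -> measurable_fun [set: 'rV[R]_d] f.
Proof.
move=> /continuousP cf.
apply: (@measurability _ _ _ _ _ _ [set A : set 'rV[R]_d | open A]) => //.
by move=> _ [A oA <-]; rewrite setTI; apply: open_measurable_rV; exact: cf.
Qed.

Lemma measurable_coord (i : 'I_d) :
  measurable_fun [set: 'rV[R]_d] (fun x : 'rV[R]_d => x 0 i).
Proof.
apply: (measurability _ (RGenOInfty.measurableE R)) => //.
move=> _ [_ [a ->] <-]; rewrite setTI; apply: open_measurable_rV.
apply: open_comp; last exact: rray_open.
by move=> x _; exact: coord_continuous.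
Qed.

Lemma open_rV_bigcup (A : set 'rV[R]_d) : open A ->
  A = \bigcup_(q : 'rV[rat]_d * nat)
        [set x | ball (map_mx ratr q.1 : 'rV[R]_d) q.2.+1%:R^-1 `<=` A /\
                 forall i, `|ratr (q.1 0 i) - x 0 i| < q.2.+1%:R^-1].
Proof.
move=> oA; apply/seteqP; split => [x Ax|x [[q n] _ /= [qA xq]]]; last first.
  apply: qA; split; first by rewrite invr_gt0.
  by move=> i j; rewrite ord1 mxE; exact: xq.
have /nbhs_ballP[e /= e0 xeA] : nbhs x A by exact: open_nbhs_nbhs.
pose n := Num.truncn (2 / e).
have ne : n.+1%:R^-1 < e / 2.
  rewrite invf_plt ?posrE ?divr_gt0// invf_div.
  exact: truncnS_gt.
have n0 : 0 < n.+1%:R^-1 :> R by rewrite invr_gt0.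
have qP i : {q : rat | ratr q \in `](x 0 i - n.+1%:R^-1), (x 0 i + n.+1%:R^-1)[}.
  by apply/cid/rat_in_itvoo; rewrite ltrD2l gtrN.
pose q : 'rV[rat]_d := \row_i sval (qP i).
have qx i : `|ratr (q 0 i) - x 0 i| < n.+1%:R^-1.
  rewrite mxE; case: (qP i) => r /=; rewrite in_itv/= => /andP[r1 r2].
  by rewrite ltr_norml ltrBrDl r1 ltrBlDl.
exists (q, n) => //=; split=> // y [_ qy]; apply: xeA; split=> // i j.
rewrite ord1; have := qy 0 j; rewrite mxE => qyj.
rewrite /ball/= (le_lt_trans (ler_distD (ratr (q 0 j)) _ _))//.
rewrite [ltRHS](splitr e) ltrD//; last exact: lt_trans qyj ne.
by rewrite distrC (lt_trans _ ne).
Qed.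

Lemma measurable_rVP d' (T : measurableType d') (f : T -> 'rV[R]_d) :
  (forall i, measurable_fun [set: T] (fun x => f x 0 i)) ->
  measurable_fun [set: T] f.
Proof.
move=> mf.
apply: (@measurability _ _ _ _ _ _ [set A : set 'rV[R]_d | open A]) => //.
move=> _ [A /= oA <-]; rewrite setTI (open_rV_bigcup oA) preimage_bigcup.
apply: countable_bigcupT_measurable => [|[q n]]; first exact: countableP.
have [qA|nqA] := pselect (ball (map_mx ratr q : 'rV[R]_d) n.+1%:R^-1 `<=` A).
  rewrite (_ : _ @^-1` _ = \bigcap_(i in [set: 'I_d])
      ((fun x => f x 0 i) @^-1` ball (ratr (q 0 i) : R) n.+1%:R^-1)).
    apply: fin_bigcap_measurable => // i _.
    rewrite -[X in measurable X]setTI; apply: mf => //.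
    exact: measurable_ball.
  apply/seteqP; split => [x [_ xq] i _|x xq]; first exact: xq.
  by split => // i; exact: xq.
by rewrite (_ : _ @^-1` _ = set0)//; apply/seteqP; split => // x [].
Qed.

Definition addrV (p : 'rV[R]_d * 'rV[R]_d) : 'rV[R]_d := p.1 + p.2.

Lemma measurable_addrV : measurable_fun [set: 'rV[R]_d * 'rV[R]_d] addrV.
Proof.
apply: measurable_rVP => i; rewrite /addrV; under eq_fun do rewrite mxE.
apply: measurable_funD.
  exact: (measurableT_comp (measurable_coord i) measurable_fst).
exact: (measurableT_comp (measurable_coord i) measurable_snd).
Qed.

HB.instance Definition _ := isMeasurableFun.Build _ _ _ _ addrV
  measurable_addrV.

End borel_rV.

Section measure_min.
Context d (T : measurableType d) (R : realType).
Local Open Scope ereal_scope.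

Definition is_measure_min (mu nu m : {measure set T -> \bar R}) : Prop :=
  [/\ forall A, measurable A -> m A <= mu A,
      forall A, measurable A -> m A <= nu A
    & forall m' : {measure set T -> \bar R},
        (forall A, measurable A -> m' A <= mu A) ->
        (forall A, measurable A -> m' A <= nu A) ->
        forall A, measurable A -> m' A <= m A].

Variables mu nu : {finite_measure set T -> \bar R}.

Lemma measure_min_exists : exists m, is_measure_min mu nu m.
Proof.
have [P [N [[mP posP] [mN negN] PN PN0]]] := Hahn_decomposition
  (cadd (charge_of_finite_measure mu)
        (copp (charge_of_finite_measure nu))).
have nuP A : measurable A -> A `<=` P -> nu A <= mu A.
  move=> mA AP; have := posP _ mA AP.
  by rewrite /cadd/copp/= sube_ge0// fin_num_measure.
have muN A : measurable A -> A `<=` N -> mu A <= nu A.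
  by move=> mA AN; have := negN _ mA AN; rewrite /cadd/copp/= sube_le0.
have split (m : {measure set T -> \bar R}) A : measurable A ->
    m A = m (A `&` N) + m (A `&` P).
  move=> mA; rewrite -measureU//; [|exact: measurableI|exact: measurableI|].
    by rewrite -setIUr setUC PN setIT.
  by rewrite setIACA setIid (setIC N) PN0 setI0.
pose m0 : {measure set T -> \bar R} :=
  measure_add (mrestr mu mN) (mrestr nu mP).
have m0E A : m0 A = mu (A `&` N) + nu (A `&` P) by exact: measure_addE.
exists m0; split.
- move=> A mA; rewrite m0E (split mu)// leeD2l//.
  by apply: nuP; [exact: measurableI|exact: subIsetr].
- move=> A mA; rewrite m0E (split nu)// leeD2r//.
  by apply: muN; [exact: measurableI|exact: subIsetr].
- move=> m' m'mu m'nu A mA; rewrite m0E (split m')//.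
  by apply: leeD; [apply: m'mu|apply: m'nu]; exact: measurableI.
Qed.

Definition measure_min : set T -> \bar R := sval (cid measure_min_exists).

HB.instance Definition _ := Measure.copy measure_min
  (sval (cid measure_min_exists)).

Lemma measure_minP : is_measure_min mu nu measure_min.
Proof. exact: svalP (cid measure_min_exists). Qed.

Let measure_min_finite : fin_num_fun measure_min.
Proof.
move=> A mA; have [le_mu _ _] := measure_minP.
by rewrite ge0_fin_numE// (le_lt_trans (le_mu A mA))// ltey_eq fin_num_measure.
Qed.

HB.instance Definition _ := Measure_isFinite.Build _ _ _
  measure_min measure_min_finite.

End measure_min.

Section convolution.
Context (R : realType) (d : nat).
Variables mu nu : probability 'rV[R]_d R.

Definition convolution := distribution (mu \x nu)%E (@addrV R d).

HB.instance Definition _ := Probability.on convolution.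

End convolution.

Section image_measure.
Context d d' (T : measurableType d) (T' : measurableType d') (R : realType).
Variables (m : {measure set T -> \bar R}) (f : {mfun T >-> T'}).

Definition image_measure : set T' -> \bar R := pushforward m f.

Let image0 : image_measure set0 = 0%E. Proof. exact: measure0. Qed.

Let image_ge0 A : (0 <= image_measure A)%E. Proof. exact: measure_ge0. Qed.

Let image_sigma_additive : semi_sigma_additive image_measure.
Proof. exact: measure_semi_sigma_additive. Qed.

HB.instance Definition _ := isMeasure.Build _ _ _ image_measure
  image0 image_ge0 image_sigma_additive.

End image_measure.

Section overlap.
Context (R : realType) (d : nat) (mu : probability 'rV[R]_d R).

Definition overlap (x : 'rV[R]_d) : set 'rV[R]_d -> \bar R :=
  measure_min mu (convolution (@dirac _ _ x R) mu).

HB.instance Definition _ x := FiniteMeasure.on (overlap x).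

Definition overlap_inf (kappa : R) : \bar R :=
  ereal_inf [set overlap z setT | z in [set z | enorm z <= kappa]].

End overlap.

Section remainder.
Context (R : realType) (d : nat) (mu : probability 'rV[R]_d R) (v : 'rV[R]_d).
Local Open Scope ereal_scope.

(* A measure has to be nonnegative on all sets, whereas the difference is only
   known to be so on measurable ones. *)
Definition remainder (A : set 'rV[R]_d) : \bar R :=
  if A \in measurable
  then mu A - 2^-1%:E * overlap mu (- v)%R A - 2^-1%:E * overlap mu v A
  else 0.

Lemma remainderE A : measurable A -> remainder A =
  mu A - 2^-1%:E * overlap mu (- v)%R A - 2^-1%:E * overlap mu v A.
Proof. by move=> mA; rewrite /remainder mem_set. Qed.

Lemma overlap_le (w : 'rV[R]_d) A : measurable A -> overlap mu w A <= mu A.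
Proof.
move=> mA.
by have [+ _ _] := measure_minP mu (convolution (dirac w) mu); apply.
Qed.

Lemma half_overlap_le A : measurable A ->
  2^-1%:E * overlap mu (- v)%R A + 2^-1%:E * overlap mu v A <= mu A.
Proof.
move=> mA; rewrite [leRHS](_ : _ = 2^-1%:E * mu A + 2^-1%:E * mu A).
  by apply: leeD; apply: lee_pmul => //; exact: overlap_le.
by rewrite -ge0_muleDl// -EFinD -[in RHS]div1r -splitr mul1e.
Qed.

Let remainder0 : remainder set0 = 0.
Proof. by rewrite remainderE// !measure0 !mule0 !sube0. Qed.

Let remainder_ge0 A : 0 <= remainder A.
Proof.
rewrite /remainder; case: ifPn => // /[!inE] mA.
rewrite -addeA -fin_num_oppeD; last by rewrite fin_numM// fin_num_measure.
rewrite sube_ge0; first exact: half_overlap_le.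
by rewrite fin_num_measure ?orbT.
Qed.

Let remainder_sigma_additive : semi_sigma_additive remainder.
Proof.
pose halfc (w : 'rV[R]_d) :=
  cscale (- 2^-1)%R (charge_of_finite_measure (overlap mu w)).
have halfcE w B : halfc w B = - (2^-1%:E * overlap mu w B).
  by rewrite -[LHS]/((- 2^-1)%:E * overlap mu w B) EFinN mulNe.
pose nu := cadd (cadd (charge_of_finite_measure mu) (halfc (- v)%R)) (halfc v).
have nuE A : measurable A -> remainder A = nu A.
  move=> mA; rewrite remainderE//.
  by rewrite -[RHS]/(mu A + halfc (- v)%R A + halfc v A) !halfcE.
move=> F mF tF mUF; rewrite nuE//.
rewrite [X in X @ _ --> _](_ : _ = (fun n => \sum_(0 <= i < n) nu (F i))).
  exact: charge_semi_sigma_additive.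
by apply/funext => n; apply: eq_bigr => i _; exact: nuE.
Qed.

HB.instance Definition _ := isMeasure.Build _ _ _ remainder
  remainder0 remainder_ge0 remainder_sigma_additive.

End remainder.

Section coupling.
Context (R : realType) (d : nat) (b : 'rV[R]_d -> 'rV[R]_d) (g : R -> R)
  (mu : probability 'rV[R]_d R) (h kappa : R).

Definition drift (x : 'rV[R]_d) : 'rV[R]_d := x + h *: b x.

Section law.
Variables x y : 'rV[R]_d.

Definition offset : 'rV[R]_d := (g h)^-1 *: truncate kappa (drift x - drift y).

Definition jump (w z : 'rV[R]_d) : 'rV[R]_d * 'rV[R]_d :=
  (drift x + g h *: z, drift y + g h *: (z + w)).

Lemma measurable_jump w : measurable_fun [set: 'rV[R]_d] (jump w).
Proof.
by apply: measurable_fun_pair; apply: measurable_rVP => i;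
  under eq_fun do rewrite !mxE; do ?apply: measurable_funD;
  do ?apply: measurable_funM; do ?apply: measurable_funD;
  exact: measurable_cst || exact: measurable_coord.
Qed.

HB.instance Definition _ w := isMeasurableFun.Build _ _ _ _ (jump w)
  (measurable_jump w).

Definition coupling : set ('rV[R]_d * 'rV[R]_d) -> \bar R :=
  measure_add
    (measure_add
      (image_measure (mscale 2^-1%:nng (overlap mu (- offset))) (jump offset))
      (image_measure (mscale 2^-1%:nng (overlap mu offset)) (jump (- offset))))
    (image_measure (remainder mu offset) (jump 0)).

HB.instance Definition _ := Measure.on coupling.

Lemma couplingE A : coupling A =
  (2^-1%:E * overlap mu (- offset) (jump offset @^-1` A) +
   2^-1%:E * overlap mu offset (jump (- offset) @^-1` A) +
   remainder mu offset (jump 0 @^-1` A))%E.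
Proof.
by rewrite /coupling measure_addE; congr (_ + _)%E; exact: measure_addE.
Qed.

Let coupling_setT : coupling setT = 1%E.
Proof.
rewrite couplingE !preimage_setT remainderE// probability_setT.
have fin w : (2^-1%:E * overlap mu w setT)%E \is a fin_num.
  by rewrite fin_numM// fin_num_measure.
rewrite -(fineK (fin offset)) -(fineK (fin (- offset))).
rewrite -!EFinB -!EFinD; congr EFin.
by rewrite [LHS]addrC -(addrA 1) -opprD subrK.
Qed.

HB.instance Definition _ := Measure_isProbability.Build _ _ _
  coupling coupling_setT.

End law.
End coupling.

Definition rho (R : realType) (d : nat) (a c r0 : R) (x y : 'rV[R]_d) : R :=
  a * (0 < enorm (x - y))%R%:R + 1 - expR (- c * enorm (x - y))
  + c * expR (- c * r0) * enorm (x - y).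

(* Main.v *)
Require Import Defs.
From HB Require Import structures.
From mathcomp Require Import all_boot all_order all_algebra.
From mathcomp Require Import all_classical all_reals all_analysis.
From mathcomp Require Import ring lra measurable_realfun.

(** Along each branch of the coupling the difference [X - Y] is deterministic.
With [D] the difference of the drifted points, [q = |D|], [kappa = g h * kappa0]
and [m = min q kappa], its length is [q - m], [q + m] or [q] according to the
branch.  The first two branches have the same mass [p / 2], because translating
by [- v] turns the overlap of [mu] with its shift by [v] into the overlap with
its shift by [- v]; and [p >= J] because [|v| <= kappa0].  Hence
[E (rho X Y) = p / 2 * f (q - m) + p / 2 * f (q + m) + (1 - p) * f q], where
[f] is the profile of [rho] as a function of the distance: the jump [a] at [0]
plus a smooth concave increasing function [psi] ([expectation_rho]).

Write [r = |x - y|] and [l = h * L < 1].  The Lipschitz condition gives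
[(1 - l) * r <= q <= (1 + l) * r].  Three mechanisms produce the contraction.

- If [q <= kappa], the two chains meet with probability [p / 2], which gains
  [a * p / 2].  The drift can cost at most [c * (1 + e^(- c r0)) * l * kappa],
  since [r < q <= kappa] whenever the drift increases the distance, and [a] is
  chosen so that [a * J / 2] exceeds twice this cost ([contraction_close]).
- If [q > kappa] and [r >= r0], dissipativity and [h < 2 K / L^2] give
  [q <= s * r] with [s < 1].  The slope of [psi] is bounded below by
  [c * e^(- c r0)], so the gain is linear in [r], like [f r] itself
  ([contraction_far]).
- If [q > kappa] and [r < r0], the second difference of [psi] with step [kappa]
  is at most [- e^(- c r) * (c * kappa / 4)^2], which counts with weight
  [p / 2 >= J / 2]; the drift costs at most [2 * c * e^(- c r) * l * r0], and [c]
  is chosen large enough for the gain to exceed this cost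
  ([contraction_middle]).

In each case the factor does not depend on [x] and [y], and the smallest of the
three gains, kept below [1], serves for all pairs. *)

Import Order.TTheory GRing.Theory Num.Theory.
Import numFieldNormedType.Exports.

Local Open Scope classical_set_scope.
Local Open Scope ring_scope.

(** * Euclidean geometry *)

Section euclidean_space.
Context {R : realType} {d : nat}.
Implicit Types (k : R) (x y : 'rV[R]_d).

Lemma innerC x y : inner x y = inner y x.
Proof. by apply: eq_bigr => i _; rewrite mulrC. Qed.

Lemma innerDl x y z : inner (x + y) z = inner x z + inner y z.
Proof. by rewrite -big_split; apply: eq_bigr => i _; rewrite mxE mulrDl. Qed.

Lemma innerZl k x y : inner (k *: x) y = k * inner x y.
Proof. by rewrite mulr_sumr; apply: eq_bigr => i _; rewrite mxE mulrA. Qed.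

Lemma inner_ge0 x : 0 <= inner x x.
Proof. by apply: sumr_ge0 => i _; rewrite -expr2 sqr_ge0. Qed.

Lemma enorm_ge0 x : 0 <= enorm x.
Proof. exact: sqrtr_ge0. Qed.

Lemma sqr_enorm x : enorm x ^+ 2 = inner x x.
Proof. by rewrite sqr_sqrtr// inner_ge0. Qed.

Lemma enormZ k x : enorm (k *: x) = `|k| * enorm x.
Proof.
rewrite /enorm innerZl innerC innerZl mulrA -expr2 sqrtrM ?sqr_ge0//.
by rewrite sqrtr_sqr.
Qed.

Lemma enorm0 : enorm (0 : 'rV[R]_d) = 0.
Proof. by rewrite -(scale0r 0) enormZ normr0 mul0r. Qed.

Lemma enorm_eq0 x : enorm x = 0 -> x = 0.
Proof.
move=> x0; apply/rowP => i; rewrite mxE; apply/eqP.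
have := sqr_enorm x; rewrite x0 expr0n/= => /esym/eqP.
rewrite psumr_eq0 => [/allP/(_ i)|j _]; last by rewrite -expr2 sqr_ge0.
by rewrite mem_index_enum mulf_eq0 orbb; exact.
Qed.

Lemma sqr_enormD x y :
  enorm (x + y) ^+ 2 = enorm x ^+ 2 + 2 * inner x y + enorm y ^+ 2.
Proof.
rewrite !sqr_enorm innerDl (innerC x (x + y)) (innerC y (x + y)) !innerDl.
by rewrite (innerC y x); ring.
Qed.

(** Cauchy-Schwarz. *)
Lemma inner_le x y : inner x y <= enorm x * enorm y.
Proof.
have [/enorm_eq0 ->|x0] := eqVneq (enorm x) 0.
  by rewrite enorm0 mul0r -(scale0r 0) innerZl mul0r.
have [/enorm_eq0 ->|y0] := eqVneq (enorm y) 0.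
  by rewrite enorm0 mulr0 -(scale0r 0) innerC innerZl mul0r.
have xy0 : 0 < enorm x * enorm y.
  by rewrite mulr_gt0// lt_neqAle eq_sym enorm_ge0 ?x0 ?y0.
have := sqr_ge0 (enorm (enorm y *: x + (- enorm x) *: y)).
(* This square equals [2 |x| |y| (|x| |y| - <x, y>)]. *)
rewrite sqr_enormD !enormZ normrN !ger0_norm ?enorm_ge0// innerZl innerC innerZl.
rewrite innerC (_ : _ + _ = 2 * (enorm x * enorm y) *
  (enorm x * enorm y - inner x y)); last by ring.
by rewrite pmulr_rge0 ?subr_ge0// mulr_gt0.
Qed.

Lemma enormD x y : enorm (x + y) <= enorm x + enorm y.
Proof.
rewrite -(@ler_pXn2r _ 2)// ?nnegrE ?addr_ge0 ?enorm_ge0// sqr_enormD.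
by have := inner_le x y; nra.
Qed.

End euclidean_space.

(** * The concave profile of the distance *)

Section concave_profile.
Context {R : realType}.
Implicit Types a c r t s : R.

Definition smooth_profile c r t : R :=
  1 - expR (- c * t) + c * expR (- c * r) * t.

(** [rho a c r x y] is convertible to [profile a c r (enorm (x - y))]. *)
Definition profile a c r t : R :=
  a * (0 < t)%R%:R + 1 - expR (- c * t) + c * expR (- c * r) * t.

Lemma profile_gt0 a c r t : 0 < t ->
  profile a c r t = a + smooth_profile c r t.
Proof. by move=> t0; rewrite /profile t0 mulr1 /smooth_profile; ring. Qed.

Lemma profile0 a c r : profile a c r 0 = 0.
Proof. by rewrite /profile ltxx !mulr0 expR0; ring. Qed.

(** By concavity the graph lies below its tangent at [s]. *)
Lemma smooth_profile_le_slope c r s t :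
  smooth_profile c r t - smooth_profile c r s <=
  c * (expR (- c * s) + expR (- c * r)) * (t - s).
Proof.
rewrite /smooth_profile (_ : - c * t = - c * s + - c * (t - s)); last by ring.
rewrite expRD; have := expR_ge1Dx (- c * (t - s)); have := expR_gt0 (- c * s).
by nra.
Qed.

Lemma smooth_profile_ge_slope c r s t : 0 <= c -> s <= t ->
  c * expR (- c * r) * (t - s) <= smooth_profile c r t - smooth_profile c r s.
Proof.
move=> c0 st; rewrite /smooth_profile.
have : expR (- c * t) <= expR (- c * s) by rewrite ler_expR; nra.
by lra.
Qed.

Lemma smooth_profile_homo c r s t : 0 <= c -> s <= t ->
  smooth_profile c r s <= smooth_profile c r t.
Proof.
move=> c0 st; have := @smooth_profile_ge_slope c r _ _ c0 st.
have : 0 <= c * expR (- c * r) * (t - s).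
  by rewrite !mulr_ge0 ?expR_ge0// subr_ge0.
by lra.
Qed.

Lemma smooth_profile0 c r : smooth_profile c r 0 = 0.
Proof. by rewrite /smooth_profile !mulr0 expR0; ring. Qed.

Lemma smooth_profile_ge0 c r t : 0 <= c -> 0 <= t -> 0 <= smooth_profile c r t.
Proof. by move=> c0 t0; rewrite -(smooth_profile0 c r) smooth_profile_homo. Qed.

Lemma profile_ge0 a c r t : 0 <= a -> 0 <= c -> 0 <= t -> 0 <= profile a c r t.
Proof.
move=> a0 c0; rewrite le_eqVlt => /predU1P[<-|t0]; first by rewrite profile0.
by rewrite profile_gt0// addr_ge0// smooth_profile_ge0// ltW.
Qed.

Lemma smooth_profile_le c r t :
  smooth_profile c r t <= c * (1 + expR (- c * r)) * t.
Proof.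
have := smooth_profile_le_slope c r 0 t.
by rewrite smooth_profile0 !subr0 mulr0 expR0.
Qed.

Lemma smooth_profile_double c r t :
  smooth_profile c r (t + t) <= 2 * smooth_profile c r t.
Proof.
rewrite /smooth_profile mulrDr expRD.
by have := sqr_ge0 (1 - expR (- c * t)); nra.
Qed.

(** The linear part of the profile has no second difference, and that of the
exponential factors as a square: this is the strict concavity which the
symmetric jumps exploit. *)
Lemma smooth_profile_second_difference c r t m :
  smooth_profile c r (t - m) + smooth_profile c r (t + m) -
    2 * smooth_profile c r t =
  - (expR (- c * (t - m)) * (1 - expR (- c * m)) ^+ 2).
Proof.
have -> : smooth_profile c r (t - m) + smooth_profile c r (t + m) -
    2 * smooth_profile c r t = 2 * expR (- c * t) - expR (- c * (t - m))
    - expR (- c * (t + m)) by rewrite /smooth_profile; ring.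
have -> : - c * t = - c * (t - m) + - c * m by ring.
have -> : - c * (t + m) = - c * (t - m) + - c * m + - c * m by ring.
by rewrite !expRD; ring.
Qed.

(** The factor [expR (u / 4)] makes up for the boundedness of [1 - expR (- u)].
The square of this inequality at [u = c * kappa] makes the second difference of
the profile at least quadratic in [c * kappa] in absolute value, however large
[c] is. *)
Lemma expR_quarter_ge (u : R) : 0 <= u ->
  u / 4 <= expR (u / 4) * (1 - expR (- u)).
Proof.
move=> u0; rewrite mulrBr mulr1 -expRD.
have := expR_ge1Dx (u / 4).
have : expR (u / 4 + - u) <= 1 by rewrite -[leRHS]expR0 ler_expR; lra.
by lra.
Qed.

(** The mean of [f] at the distance after one step of the coupling, from points
whose drifted distance is [q]; here [m] is the length of the reflected jump and
[p] the common mass of the two overlap measures. *)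
Definition step_mean (f : R -> R) (p q m : R) : R :=
  p / 2 * f (q - m) + p / 2 * f (q + m) + (1 - p) * f q.

(** A fixed gain is a contraction as long as the profile stays bounded. *)
Lemma contraction_of_gain a (M delta : R) : 0 < a -> 0 <= M -> 0 < delta ->
  exists2 eps : R, 0 < eps & forall E psi, psi <= M ->
    E <= a + psi - delta -> E <= (1 - eps) * (a + psi).
Proof.
move=> a0 M0 d0; have aM : 0 < a + M by lra.
exists (delta / (a + M)); first by rewrite divr_gt0.
move=> E psi psiM /le_trans; apply.
rewrite mulrBl mul1r lerD2l lerN2 mulrAC ler_pdivrMr// ler_pM2l//.
by rewrite lerD2l.
Qed.

End concave_profile.

(** * Contraction in the three regimes *)

Section regimes.
Context {R : realType}.
Variables (l kappa r0 J c a : R).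
Hypotheses (l_gt0 : 0 < l) (kappa_gt0 : 0 < kappa).
Local Notation e0 := (expR (- c * r0)).
Local Notation f := (profile a c r0).
Local Notation psi := (smooth_profile c r0).

(** The chains may meet: the jump [a] of the profile at [0] pays for the drift.
Here the jump length is [q] itself, and [kappa / (1 - l)] bounds the initial
distance. *)
Lemma contraction_close : l < 1 -> 0 < J -> 1 <= c -> 1 < a ->
  (a - 1) * J = 4 * (c * (1 + expR (- c * r0))) * (l * kappa) ->
  exists2 eps : R, 0 < eps & forall p q r : R,
  J <= p -> p <= 1 -> 0 < r -> 0 < q -> (1 - l) * r <= q -> q <= (1 + l) * r ->
  q <= kappa -> step_mean f p q q <= (1 - eps) * f r.
Proof.
move=> l_lt1 J_gt0 c_ge1 a_gt1 aE.
have c_gt0 : 0 < c by exact: lt_le_trans c_ge1.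
have e0_gt0 : 0 < e0 := expR_gt0 _.
have slope_gt0 : 0 < c * (1 + e0) by rewrite mulr_gt0// addr_gt0.
have l0 := l_gt0; have k0 := kappa_gt0.
pose M := c * (1 + e0) * (kappa / (1 - l)).
have M0 : 0 <= M by rewrite mulr_ge0 ?divr_ge0 ?ltW// subr_gt0.
have a0 : 0 < a by apply: lt_trans a_gt1.
have [eps eps0 epsP] :=
  @contraction_of_gain R a M (J / 2) a0 M0 (divr_gt0 J_gt0 (ltr0n _ 2)).
exists eps => // p q r Jp p1 r0' q0 lq qu qk.
rewrite /step_mean subrr profile0 !profile_gt0//; last by rewrite addr_gt0.
rewrite mulr0 add0r; apply: epsP.
  apply: le_trans (smooth_profile_le c r0 r) _.
  rewrite ler_pM2l// ler_pdivlMr ?subr_gt0// mulrC.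
  exact: le_trans qk.
have psi2 : psi (q + q) <= 2 * psi q := smooth_profile_double c r0 q.
(* If the drift increases the distance, then [r < q <= kappa], so the increase
   [q - r <= l * r] is at most [l * kappa]. *)
have psiq : psi q <= psi r + c * (1 + e0) * (l * kappa).
  have [qr|rq] := leP q r.
    have := @smooth_profile_homo R c r0 _ _ (ltW c_gt0) qr.
    have : 0 < c * (1 + e0) * (l * kappa).
      by rewrite (mulr_gt0 slope_gt0)// mulr_gt0.
    by lra.
  have := smooth_profile_le_slope c r0 r q.
  have er : expR (- c * r) <= 1.
    by rewrite -[leRHS]expR0 ler_expR mulNr oppr_le0 ltW// mulr_gt0.
  have : c * (expR (- c * r) + e0) * (q - r) <= c * (1 + e0) * (l * kappa).
    apply: ler_pM; rewrite ?subr_ge0 ?(ltW rq)//.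
    - exact: mulr_ge0 (ltW c_gt0) (addr_ge0 (expR_ge0 _) (ltW e0_gt0)).
    - by rewrite ler_pM2l// lerD2r.
    - by nra.
  by lra.
have aJ : a * J <= a * p by rewrite ler_pM2l.
have pp : p / 2 * psi (q + q) <= p / 2 * (2 * psi q).
  by rewrite ler_pM2l// divr_gt0//; exact: lt_le_trans Jp.
have aJE : a * J = 4 * (c * (1 + e0) * (l * kappa)) + J.
  by have := aE; lra.
have : 0 < c * (1 + e0) * (l * kappa).
  by rewrite (mulr_gt0 slope_gt0)// mulr_gt0.
by nra.
Qed.

Lemma step_mean_far (p q : R) : kappa < q ->
  step_mean f p q kappa = a + psi q -
    p / 2 * (expR (- c * (q - kappa)) * (1 - expR (- c * kappa)) ^+ 2).
Proof.
move=> kq; have q0 := lt_trans kappa_gt0 kq.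
rewrite /step_mean !profile_gt0 ?subr_gt0 ?addr_gt0//.
have := smooth_profile_second_difference c r0 q kappa.
move=> /(congr1 (fun z => p / 2 * z)); rewrite mulrN => <-.
by field.
Qed.

(** The drift contracts the distance by [s].  Both the gain and the profile are
of order [r], since [r > kappa / 2] turns the constant [a] into a multiple of
[r]; the second difference only helps. *)
Lemma contraction_far (s : R) : l < 1 -> 1 <= c -> 1 < a -> s < 1 ->
  exists2 eps : R, 0 < eps & forall p q r : R,
  0 <= p -> 0 < r -> q <= (1 + l) * r -> kappa < q -> q <= s * r ->
  step_mean f p q kappa <= (1 - eps) * f r.
Proof.
move=> l_lt1 c_ge1 a_gt1 s1.
have c_gt0 : 0 < c by exact: lt_le_trans c_ge1.
have e0_gt0 : 0 < e0 := expR_gt0 _.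
have slope_gt0 : 0 < c * (1 + e0) by rewrite mulr_gt0// addr_gt0.
have l0 := l_gt0; have k0 := kappa_gt0.
(* [A * r] dominates [a + psi r] once [r > kappa / 2]. *)
pose A := a / (kappa / 2) + c * (1 + e0).
have A0 : 0 < A.
  by rewrite addr_gt0// divr_gt0//; [exact: lt_trans a_gt1|exact: divr_gt0].
exists (c * e0 * (1 - s) / A); first by rewrite divr_gt0// !mulr_gt0// subr_gt0.
move=> p q r p_ge0 r_gt0 qu kq qs; rewrite step_mean_far// profile_gt0//.
have gain : c * e0 * (1 - s) * r <= psi r - psi q.
  have qr : q <= r by nra.
  apply: le_trans (@smooth_profile_ge_slope R c r0 _ _ (ltW c_gt0) qr).
  by rewrite -mulrA ler_pM2l ?mulr_gt0//; nra.
have fA : a + psi r <= A * r.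
  have : psi r <= c * (1 + e0) * r := smooth_profile_le c r0 r.
  rewrite /A mulrDl => psir; apply: lerD => //.
  rewrite -mulrA ler_pMr ?(lt_trans _ a_gt1)// mulrC ler_pdivlMr ?divr_gt0//.
  by nra.
have : c * e0 * (1 - s) / A * (a + psi r) <= c * e0 * (1 - s) * r.
  have -> : c * e0 * (1 - s) * r = c * e0 * (1 - s) / A * (A * r).
    by field; exact: lt0r_neq0.
  by rewrite ler_wpM2l// ltW// divr_gt0// !mulr_gt0// subr_gt0.
have : 0 <= p / 2 * (expR (- c * (q - kappa)) * (1 - expR (- c * kappa)) ^+ 2).
  apply: mulr_ge0; last by rewrite mulr_ge0 ?expR_ge0// sqr_ge0.
  by rewrite divr_ge0.
by lra.
Qed.

(** The drift may increase the distance by up to [l * r0], but concavity wins.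
Since [l * r0 <= kappa / 2], the factor [expR (- c * (q - kappa))] of the second
difference is still at least [expR (- c * r) * expR (c * kappa / 2)]. *)
Lemma contraction_middle : 0 <= r0 -> 2 * l * r0 <= kappa ->
  0 < J -> 1 <= c -> 0 < a ->
  (c - 1) * (kappa ^+ 2 * J) = 64 * l * r0 ->
  exists2 eps : R, 0 < eps & forall p q r : R,
  J <= p -> 0 < r -> q <= (1 + l) * r -> kappa < q -> r < r0 ->
  step_mean f p q kappa <= (1 - eps) * f r.
Proof.
move=> r0_ge0 l_r0 J_gt0 c_ge1 a0 cE.
have c_gt0 : 0 < c by exact: lt_le_trans c_ge1.
have l0 := l_gt0; have k0 := kappa_gt0.
have e0_gt0 : 0 < e0 := expR_gt0 _.
have delta0 : 0 < e0 * (c * kappa ^+ 2 * J / 32).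
  by rewrite mulr_gt0// divr_gt0// !mulr_gt0// exprn_gt0.
have [eps eps0 epsP] := contraction_of_gain a _ _ a0
  (smooth_profile_ge0 _ r0 _ (ltW c_gt0) r0_ge0) delta0.
exists eps => // p q r Jp r_gt0 qu kq rr0.
rewrite step_mean_far// profile_gt0//; apply: epsP.
  exact: smooth_profile_homo _ _ _ _ (ltW c_gt0) (ltW rr0).
set E := expR (- c * (q - kappa)) * _; set er := expR (- c * r).
have er0 : e0 <= er.
  by rewrite ler_expR !mulNr lerN2 ler_pM2l// ltW.
have loss : psi q - psi r <= 2 * c * er * (l * r0).
  have [qr|rq] := leP q r.
    have := @smooth_profile_homo R c r0 _ _ (ltW c_gt0) qr.
    have : 0 <= 2 * c * er * (l * r0).
      by rewrite !mulr_ge0 ?expR_ge0// ltW.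
    by lra.
  apply: le_trans (smooth_profile_le_slope c r0 r q) _; rewrite -/er.
  apply: ler_pM; rewrite ?subr_ge0 ?(ltW rq)//.
  - exact: mulr_ge0 (ltW c_gt0) (addr_ge0 (expR_ge0 _) (ltW e0_gt0)).
  - by rewrite (mulrC 2) -mulrA ler_pM2l//; lra.
  - by nra.
have gainE : er * ((c * kappa / 4) ^+ 2) <= E.
  have u0 : 0 <= c * kappa by rewrite mulr_ge0// ltW.
  have h1 := expR_quarter_ge _ u0.
  have : (c * kappa / 4) ^+ 2 <=
      expR (c * kappa / 2) * (1 - expR (- c * kappa)) ^+ 2.
    rewrite (_ : c * kappa / 2 = c * kappa / 4 + c * kappa / 4); last by field.
    rewrite expRD -expr2 -exprMn mulNr ler_pXn2r ?nnegrE ?divr_ge0//.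
    by apply: le_trans h1; rewrite divr_ge0.
  rewrite -(ler_pM2l (expR_gt0 (- c * r))) => /le_trans; apply.
  rewrite mulrA -expRD /E ler_wpM2r ?sqr_ge0// ler_expR.
  rewrite (_ : _ + _ = - c * (r - kappa / 2)); last by field.
  have qr : q - kappa <= r - kappa / 2.
    have : l * r <= l * r0 by rewrite ler_pM2l// ltW.
    by lra.
  by rewrite !mulNr lerN2 ler_pM2l.
have E0 : 0 <= E by rewrite /E mulr_ge0 ?expR_ge0// sqr_ge0.
have pE : J / 2 * E <= p / 2 * E by rewrite ler_wpM2r// ler_pM2r.
have JE : J / 2 * (er * ((c * kappa / 4) ^+ 2)) <= J / 2 * E.
  by rewrite ler_wpM2l// divr_ge0// ltW.
(* The choice of [c] makes the loss the part [(c - 1) / c] of the gain; the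
   summand [1] in [c] leaves the rest. *)
have lossE : 2 * c * er * (l * r0) = er * (c * (c - 1) * kappa ^+ 2 * J / 32).
  have -> : l * r0 = (c - 1) * (kappa ^+ 2 * J) / 64 by rewrite cE; field.
  by field.
have gE : J / 2 * (er * ((c * kappa / 4) ^+ 2)) =
   er * (c * (c - 1) * kappa ^+ 2 * J / 32) + er * (c * kappa ^+ 2 * J / 32).
  by field.
have : e0 * (c * kappa ^+ 2 * J / 32) <= er * (c * kappa ^+ 2 * J / 32).
  by rewrite ler_wpM2r// divr_ge0// !mulr_ge0// ltW// exprn_gt0.
by lra.
Qed.

End regimes.

(** * The law of the distance under the coupling *)

Section overlap_mass.
Context {R : realType} {d : nat} (mu : probability 'rV[R]_d R).
Implicit Types z : 'rV[R]_d.
Local Open Scope ereal_scope.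

Definition translation z (x : 'rV[R]_d) : 'rV[R]_d := (z + x)%R.

Lemma measurable_translation z : measurable_fun [set: 'rV[R]_d] (translation z).
Proof.
apply: measurable_rVP => i; under eq_fun do rewrite mxE.
by apply: measurable_funD; [exact: measurable_cst|exact: measurable_coord].
Qed.

HB.instance Definition _ z := isMeasurableFun.Build _ _ _ _ (translation z)
  (measurable_translation z).

Lemma measurable_translation_preimage z (A : set 'rV[R]_d) :
  measurable A -> measurable (translation z @^-1` A).
Proof.
by move=> mA; rewrite -[X in measurable X]setTI; exact: measurable_translation.
Qed.

Lemma convolution_dirac z (A : set 'rV[R]_d) : measurable A ->
  convolution (dirac z) mu A = mu (translation z @^-1` A).
Proof.
move=> mA.
have mB : measurable (@addrV R d @^-1` A).
  by rewrite -[X in measurable X]setTI; exact: measurable_addrV.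
rewrite /convolution /distribution /pushforward /= /product_measure1.
rewrite integral_dirac//; last exact: measurable_fun_xsection.
rewrite diracT mul1e /=; congr (mu _); apply/seteqP.
by split=> x; rewrite /xsection /= inE.
Qed.

(** The image under translation by [- z] of the minimum of [mu] and its shift by
[z] lies below both [mu] and its shift by [- z], hence below their minimum. *)
Lemma le_overlap_opp z : overlap mu z setT <= overlap mu (- z)%R setT.
Proof.
have [le_mu le_z _] := measure_minP mu (convolution (dirac z) mu).
have [_ _ max_m] := measure_minP mu (convolution (dirac (- z)%R) mu).
have le_zE B : measurable B -> overlap mu z B <= mu (translation z @^-1` B).
  by move=> mB; rewrite -convolution_dirac//; exact: le_z.
rewrite -[leLHS]/(image_measure (overlap mu z) (translation (- z)%R) setT).
apply: max_m => // A mA;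
  have mzA := measurable_translation_preimage (- z)%R _ mA.
  apply: le_trans (le_zE _ mzA) _.
  rewrite -comp_preimage (_ : _ \o _ = id)//.
  by apply/funext => x; rewrite /translation /= addKr.
rewrite -[leRHS]/(convolution (dirac (- z)%R) mu A) convolution_dirac//.
exact: le_mu.
Qed.

Lemma overlap_opp z : overlap mu (- z)%R setT = overlap mu z setT.
Proof.
apply/eqP; rewrite eq_le le_overlap_opp andbT.
by have := le_overlap_opp (- z)%R; rewrite opprK.
Qed.

End overlap_mass.

Section coupling_expectation.
Context {R : realType} {d : nat} (b : 'rV[R]_d -> 'rV[R]_d) (g : R -> R).
Context (mu : probability 'rV[R]_d R) (h kappa : R) (x y : 'rV[R]_d).
Local Notation v := (offset b g h kappa x y).
Local Notation jump := (jump b g h x y).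

(** On each branch the integrand is constant, so only the mass of the branch
matters. *)
Lemma integral_image_cst (m : {measure set 'rV[R]_d -> \bar R}) w
    (F : 'rV[R]_d * 'rV[R]_d -> R) k :
  measurable_fun [set: 'rV[R]_d * 'rV[R]_d] F -> (forall z, 0 <= F z) ->
  (forall z, F (jump w z) = k) ->
  (\int[image_measure m (jump w)]_z (F z)%:E = k%:E * m setT)%E.
Proof.
move=> mF F0 Fk; rewrite ge0_integral_pushforward//.
- by under eq_integral do rewrite /= Fk; rewrite preimage_setT integral_cst.
- exact/measurable_EFinP.
- by move=> z _; rewrite lee_fin.
Qed.

Lemma expectation_coupling (F : 'rV[R]_d * 'rV[R]_d -> R) (k : 'rV[R]_d -> R) :
  measurable_fun [set: 'rV[R]_d * 'rV[R]_d] F -> (forall z, 0 <= F z) ->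
  (forall w z, F (jump w z) = k w) ->
  let p := fine (overlap mu v setT) in
  ('E_(coupling b g mu h kappa x y)[F] =
   (p / 2 * k v + p / 2 * k (- v) + (1 - p) * k 0)%:E)%E.
Proof.
move=> mF F0 Fk p; rewrite unlock /coupling.
have mF' : measurable_fun [set: 'rV[R]_d * 'rV[R]_d] (EFin \o F).
  exact/measurable_EFinP.
have F0' z : setT z -> (0 <= (F z)%:E)%E by rewrite lee_fin.
rewrite !ge0_integral_measure_add//.
rewrite !(integral_image_cst _ _ _ _ mF F0 (Fk _)).
transitivity ((k v)%:E * (2^-1%:E * overlap mu (- v)%R setT) +
  (k (- v))%:E * (2^-1%:E * overlap mu v setT) +
  (k 0)%:E * remainder mu v setT)%E; first by [].
rewrite remainderE// overlap_opp probability_setT.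
have pE : overlap mu v setT = p%:E by rewrite /p fineK// fin_num_measure.
rewrite pE -!(EFinM, EFinB, EFinD); congr EFin.
by field.
Qed.

End coupling_expectation.

Section measurable_rho.
Context {R : realType} {d : nat}.

Lemma measurable_enormB :
  measurable_fun [set: 'rV[R]_d * 'rV[R]_d] (fun z => enorm (z.1 - z.2)).
Proof.
apply: (measurableT_comp (f := @Num.sqrt R)).
  by apply: continuous_measurable_fun; exact: sqrt_continuous.
apply: measurable_sum => i; under eq_fun do rewrite !mxE.
have mi j : measurable_fun [set: 'rV[R]_d * 'rV[R]_d]
    (fun z => z.1 0 j - z.2 0 j).
  apply: measurable_funB.
    exact: (measurableT_comp (measurable_coord j) measurable_fst).
  exact: (measurableT_comp (measurable_coord j) measurable_snd).
exact: measurable_funM.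
Qed.

Lemma measurable_rho a c r0 : measurable_fun [set: 'rV[R]_d * 'rV[R]_d]
  (fun z => rho a c r0 z.1 z.2).
Proof.
rewrite /rho; have mn := measurable_enormB.
apply: measurable_funD; last exact: measurable_funM.
apply: measurable_funB.
  apply: measurable_funD => //; apply: measurable_funM => //.
  rewrite (_ : (fun _ => _) =
      (fun z => if 0 < enorm (z.1 - z.2) then 1 else 0)).
    apply: measurable_fun_if => //.
    exact: measurable_fun_ltr.
  by apply/funext => z; case: ifP.
apply: measurableT_comp; first exact: measurable_expR.
exact: measurable_funM.
Qed.

End measurable_rho.

(** A multiplier form of truncation that includes the zero vector, where the
multiplier is [0]. *)
Lemma truncate_collinear (R : realType) (d : nat) (kappa : R) (x : 'rV[R]_d) :
  0 < kappa -> exists2 lam : R, truncate kappa x = lam *: x &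
    0 <= lam <= 1 /\ lam * enorm x = Num.min (enorm x) kappa.
Proof.
move=> k0; exists (Num.min 1 (kappa / enorm x)) => //; split.
  by rewrite ge_min lexx le_min ler01 divr_ge0// ?enorm_ge0// ltW.
have [->|x0] := eqVneq (enorm x) 0; first by rewrite mulr0 min_l// ltW.
by rewrite minr_pMl ?enorm_ge0// mul1r divfK.
Qed.

Section one_step.
Context {R : realType} {d : nat} (b : 'rV[R]_d -> 'rV[R]_d) (L K r0 h : R).
Hypothesis h_gt0 : 0 < h.
Hypothesis b_lip : forall x y, enorm (b x - b y) <= L * enorm (x - y).

Lemma drift_sub x y : drift b h x - drift b h y = (x - y) + h *: (b x - b y).
Proof. by rewrite /drift scalerBr opprD addrACA. Qed.

Lemma drift_dist_le x y :
  enorm (drift b h x - drift b h y) <= (1 + h * L) * enorm (x - y).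
Proof.
rewrite drift_sub (le_trans (enormD _ _))// enormZ gtr0_norm// mulrDl mul1r.
by rewrite lerD2l -mulrA ler_pM2l.
Qed.

Lemma drift_dist_ge x y :
  (1 - h * L) * enorm (x - y) <= enorm (drift b h x - drift b h y).
Proof.
have xyE : x - y = (drift b h x - drift b h y) + - h *: (b x - b y).
  by rewrite drift_sub scaleNr addrK.
rewrite mulrBl mul1r lerBlDr {1}xyE (le_trans (enormD _ _))// lerD2l.
by rewrite enormZ normrN gtr0_norm// -mulrA ler_pM2l.
Qed.

(** Expanding the square, dissipativity bounds the cross term and the Lipschitz
condition the last one. *)
Lemma drift_dist_contract x y :
  0 <= L -> inner (x - y) (b x - b y) <= - K * enorm (x - y) ^+ 2 ->
  enorm (drift b h x - drift b h y) <=
    Num.sqrt (1 - 2 * h * K + h ^+ 2 * L ^+ 2) * enorm (x - y).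
Proof.
move=> L0 dissip.
rewrite -(ger0_norm (enorm_ge0 (drift b h x - _))) -sqrtr_sqr.
rewrite -[enorm (x - y) in leRHS](ger0_norm (enorm_ge0 _)) -sqrtr_sqr.
rewrite mulrC -sqrtrM ?sqr_ge0// ler_wsqrtr// drift_sub sqr_enormD.
rewrite enormZ gtr0_norm// (innerC (x - y)) innerZl (innerC _ (x - y)).
have lip : h ^+ 2 * enorm (b x - b y) ^+ 2 <= h ^+ 2 * (L * enorm (x - y)) ^+ 2.
  by rewrite ler_wpM2l ?sqr_ge0// ler_pXn2r ?nnegrE ?mulr_ge0 ?enorm_ge0.
have := dissip; rewrite -(ler_pM2l h_gt0); move: lip.
by rewrite exprMn; lra.
Qed.

Context (g : R -> R) (mu : probability 'rV[R]_d R) (kappa0 : R).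
Hypotheses (g_gt0 : 0 < g h) (kappa0_gt0 : 0 < kappa0).
Local Notation kappa := (g h * kappa0).
Local Notation J := (fine (overlap_inf mu kappa0)).

Let kappa_gt0 : 0 < kappa. Proof. exact: mulr_gt0. Qed.

Lemma overlap_inf_le v : enorm v <= kappa0 -> (0 < overlap_inf mu kappa0)%E ->
  J <= fine (overlap mu v setT) <= 1.
Proof.
move=> vk inf_gt0.
have inf_le : (overlap_inf mu kappa0 <= overlap mu v setT)%E.
  by apply: ereal_inf_lbound; exists v.
have v_fin : overlap mu v setT \is a fin_num by rewrite fin_num_measure.
apply/andP; split.
  apply: fine_le => //; rewrite gt0_fin_numE//.
  by rewrite (le_lt_trans inf_le)// ltey_eq v_fin.
rewrite -lee_fin fineK// -(probability_setT mu).
exact: overlap_le.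
Qed.

(** The jump is collinear with the drifted difference [D], so that the three
branches move the distance to [q - m], [q + m] and [q]. *)
Lemma expectation_rho a c x y : 0 <= a -> 0 <= c ->
  (0 < overlap_inf mu kappa0)%E ->
  let q := enorm (drift b h x - drift b h y) in
  exists2 p : R, J <= p <= 1 &
    ('E_(coupling b g mu h kappa x y) [fun XY => rho a c r0 XY.1 XY.2] =
      (step_mean (profile a c r0) p q (Num.min q kappa))%:E)%E.
Proof.
move=> a0 c0 inf_gt0 q; set D := drift b h x - drift b h y in q *.
have [lam truncE [/andP[lam0 lam1] lamE]] :=
  truncate_collinear _ _ _ D kappa_gt0.
pose v := offset b g h kappa x y.
have gv : g h *: v = lam *: D.
  by rewrite /v /offset truncE scalerA divff ?scale1r// gt_eqF.
exists (fine (overlap mu v setT)).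
  apply: overlap_inf_le => //.
  have -> : enorm v = (g h)^-1 * Num.min q kappa.
    rewrite -lamE /v /offset truncE !enormZ !ger0_norm//.
    by rewrite invr_ge0 ltW.
  by rewrite ler_pdivrMl// ge_min lexx orbT.
rewrite (expectation_coupling _ _ _ _ _ _ _ _
  (fun w => profile a c r0 (enorm (D - g h *: w)))).
- rewrite /step_mean -/v scalerN opprK gv scaler0 subr0 -lamE.
  have -> : enorm (D - lam *: D) = q - lam * q.
    rewrite -[X in X - _]scale1r -scalerBl enormZ ger0_norm ?subr_ge0//.
    by rewrite mulrBl mul1r.
  have -> // : enorm (D + lam *: D) = q + lam * q.
  rewrite -[X in X + _]scale1r -scalerDl enormZ ger0_norm ?addr_ge0//.
  by rewrite mulrDl mul1r.
- exact: measurable_rho.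
- by move=> z; exact: profile_ge0 (enorm_ge0 _).
- move=> w z; rewrite /jump /rho /profile /=.
  suff -> : drift b h x + g h *: z - (drift b h y + g h *: (z + w)) =
    D - g h *: w by [].
  by rewrite /D; apply/rowP => i; rewrite !mxE; ring.
Qed.

End one_step.

(** * Contraction in expectation *)

Theorem theorem3p3 (R : realType) (d : nat) (d_gt0 : (0 < d)%N)
    (b : 'rV[R]_d -> 'rV[R]_d) (g : R -> R) (mu : probability 'rV[R]_d R)
    (L K r0 kappa0 h : R)
    (g_cont : {within `[0, +oo[, continuous g})
    (g_incr : forall s t : R, 0 <= s -> s < t -> g s < g t)
    (g_0 : g 0 = 0)
    (L_ge0 : 0 <= L)
    (c1 : forall x y, enorm (b x - b y) <= L * enorm (x - y))
    (K_gt0 : 0 < K) (r0_ge0 : 0 <= r0)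
    (c2 : forall x y, r0 <= enorm (x - y) ->
      inner (x - y) (b x - b y) <= - K * enorm (x - y) ^+ 2)
    (kappa0_gt0 : 0 < kappa0)
    (c3 : (0 < overlap_inf mu kappa0)%E)
    (h_over_g : t / g t @[t --> 0^'+] --> 0)
    (h_gt0 : 0 < h)
    (h_lt : h < Num.min (2 * K * L ^- 2) L^-1)
    (h_g : r0 = 0 \/ h / g h <= kappa0 * (2 * L * r0)^-1) :
  let J := fine (overlap_inf mu kappa0) in
  let c := 64 * h * L * r0 / (g h ^+ 2 * kappa0 ^+ 2 * J) + 1 in
  let a := 4 * c * (1 + expR (- c * r0)) * h * g h * kappa0 * L / J + 1 in
  exists c_star : R, 0 < c_star < 1 /\
    forall x y : 'rV[R]_d,
      ('E_(coupling b g mu h (g h * kappa0) x y)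
          [fun XY => rho a c r0 XY.1 XY.2]
        <= ((1 - c_star) * rho a c r0 x y)%:E)%E.
Proof.
move=> J c a.
have g_gt0 : 0 < g h by rewrite -g_0 g_incr.
have [hK hL] : h < 2 * K * L ^- 2 /\ h < L^-1.
  by move: h_lt; rewrite lt_min => /andP.
(* If [L] were [0], then [h < L^-1 = 0]. *)
have L_gt0 : 0 < L by rewrite -invr_gt0 (lt_trans h_gt0).
pose kappa := g h * kappa0; pose l := h * L.
have kappa_gt0 : 0 < kappa by exact: mulr_gt0.
have l_gt0 : 0 < l by exact: mulr_gt0.
have l_lt1 : l < 1 by rewrite /l -ltr_pdivlMr// div1r.
have theta : 1 - 2 * h * K + h ^+ 2 * L ^+ 2 < 1.
  move: hK; rewrite ltr_pdivlMr ?exprn_gt0// -(ltr_pM2l h_gt0).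
  by rewrite expr2; lra.
have l_r0 : 2 * l * r0 <= kappa.
  case: h_g => [->|hg]; first by rewrite mulr0 ltW.
  have [->|r0_neq0] := eqVneq r0 0; first by rewrite mulr0 ltW.
  have r0_gt0 : 0 < r0 by rewrite lt_neqAle eq_sym r0_neq0.
  move: hg; rewrite ler_pdivlMr ?mulr_gt0// mulrAC ler_pdivrMr//.
  by rewrite /kappa /l (mulrC kappa0); lra.
have J_gt0 : 0 < J.
  apply: fine_gt0; rewrite c3 /=.
  have : (overlap_inf mu kappa0 <= overlap mu 0%R setT)%E.
    by apply: ereal_inf_lbound; exists 0 => //=; rewrite enorm0 ltW.
  move=> /le_lt_trans; apply.
  by rewrite ltey_eq fin_num_measure.
have cE : (c - 1) * (kappa ^+ 2 * J) = 64 * l * r0.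
  rewrite /c addrK /kappa /l exprMn; field.
  by rewrite !gt_eqF.
have c_ge1 : 1 <= c.
  by rewrite lerDr divr_ge0// !mulr_ge0// ?exprn_ge0// ltW.
have c_gt0 : 0 < c by exact: lt_le_trans c_ge1.
have aE : (a - 1) * J = 4 * (c * (1 + expR (- c * r0))) * (l * kappa).
  by rewrite /a addrK divfK ?gt_eqF// /l /kappa; ring.
have a_gt1 : 1 < a.
  by rewrite /a ltrDr divr_gt0// !mulr_gt0// addr_gt0// expR_gt0.
have a_gt0 : 0 < a by exact: lt_trans a_gt1.
(* From here on only the defining equations of [a] and [c] are used. *)
clearbody a c.
have s_lt1 : Num.sqrt (1 - 2 * h * K + h ^+ 2 * L ^+ 2) < 1.
  by rewrite -[ltRHS]sqrtr1 ltr_sqrt.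
have [e1 e1_gt0 close] := contraction_close l kappa r0 J c a l_gt0 kappa_gt0
  l_lt1 J_gt0 c_ge1 a_gt1 aE.
have [e2 e2_gt0 far] := contraction_far l kappa r0 c a l_gt0 kappa_gt0 _
  l_lt1 c_ge1 a_gt1 s_lt1.
have [e3 e3_gt0 middle] := contraction_middle l kappa r0 J c a l_gt0 kappa_gt0
  r0_ge0 l_r0 J_gt0 c_ge1 a_gt0 cE.
(* The entry [2^-1] keeps [e] below [1]. *)
pose e := Num.min 2^-1 (Num.min e1 (Num.min e2 e3)).
exists e; split.
  rewrite /e !lt_min !invr_gt0 ltr0n e1_gt0 e2_gt0 e3_gt0/= gt_min.
  by rewrite invf_lt1// ltr1n.
move=> x y.
have [p /andP[Jp p1] ->] := expectation_rho b r0 h g mu kappa0 g_gt0 kappa0_gt0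
  a c x y (ltW a_gt0) (ltW c_gt0) c3.
rewrite lee_fin -[rho _ _ _ _ _]/(profile a c r0 (enorm (x - y))).
have q_le := drift_dist_le b L h h_gt0 c1 x y.
have q_ge := drift_dist_ge b L h h_gt0 c1 x y.
have q_contract := drift_dist_contract b L K h h_gt0 c1 x y L_ge0.
move: (c2 x y) q_le q_ge q_contract; rewrite -/kappa -/l.
set q := enorm (drift b h x - _); set r := enorm (x - y) => c2xy.
move=> q_le q_ge q_contract.
have r_ge0 : 0 <= r := enorm_ge0 _.
have e_weaken eps E : e <= eps -> E <= (1 - eps) * profile a c r0 r ->
    E <= (1 - e) * profile a c r0 r.
  move=> e_eps /le_trans; apply; rewrite ler_wpM2r ?lerD2l ?lerN2//.
  by rewrite profile_ge0// ltW.
(* Coinciding points stay together: both sides vanish. *)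
have [r_eq0|r_neq0] := eqVneq r 0.
  have q0 : q = 0.
    by apply/eqP; rewrite eq_le enorm_ge0 andbT -(mulr0 (1 + l)) -r_eq0.
  rewrite q0 r_eq0 min_l; last exact: ltW.
  by rewrite /step_mean subrr addr0 profile0 !mulr0 !addr0.
have r_gt0 : 0 < r by rewrite lt_neqAle eq_sym r_neq0.
have q_gt0 : 0 < q.
  by apply: lt_le_trans q_ge; rewrite mulr_gt0// subr_gt0.
have [q_kappa|kappa_q] := leP q kappa.
  apply: (e_weaken e1); first by rewrite /e !ge_min lexx !orbT.
  exact: close.
have [r0_r|r_r0] := leP r0 r.
  apply: (e_weaken e2); first by rewrite /e !ge_min lexx !orbT.
  apply: far => //; first exact: le_trans (ltW J_gt0) Jp.
  by apply: q_contract; exact: c2xy.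
apply: (e_weaken e3); first by rewrite /e !ge_min lexx !orbT.
exact: middle.
Qed.
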